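(* The radial function $A(r)$ has the series expansion $$A(r)=\sum_{n=0}^\infty c_nG_n^{(3)}(r).$$ The series converges pointwise (for $r>0$) and in $L^2(\mathbb{R}^3)$, where $A$ and the $G_n^{(3)}$ are regarded as radial functions on $\mathbb{R}^3$.
   Context: For $x>0$ let $\omega(x)=\sum_{m=1}^\infty(2\pi^2m^4x^2-3\pi m^2x)e^{-\pi m^2x}$. Define $$A(r)=\int_0^\infty\omega(x)e^{-\pi xr^2}\,dx\qquad(r>0),$$ which equals $\frac{d^2}{dr^2}\left(\frac r4\coth(\pi r)\right)$, and for $n\ge0$ $$c_n=2\sqrt2\int_0^\infty\frac{\omega(x)}{(x+1)^{3/2}}\left(\frac{x-1}{x+1}\right)^n\,dx .$$ Define $$G_n^{(3)}(r)=e^{-\pi r^2}L_n^{1/2}(2\pi r^2)\qquad(r>0),$$ where $L_n^\alpha(x)=\sum_{k=0}^n\frac{(-1)^k}{k!}\binom{n+\alpha}{n-k}x^k$ are the generalized Laguerre polynomials. A function $F$ on $(0,\infty)$ is regarded as a radial function on $\mathbb{R}^3$ via $\mathbf{x}\mapsto F(|\mathbf{x}|)$. *)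

(* Defs.v *)
From HB Require Import structures.
From mathcomp Require Import all_boot all_order all_algebra.
From mathcomp Require Import all_classical all_reals all_analysis.
Set Implicit Arguments.
Unset Strict Implicit.
Unset Printing Implicit Defensive.
Import Order.TTheory GRing.Theory Num.Theory.
Import numFieldNormedType.Exports.
Local Open Scope classical_set_scope.
Local Open Scope ring_scope.

Definition omega {R : realType} (x : R) : R :=
  \big[+%R/0]_(1 <= m <oo)
    ((2 * pi ^+ 2 * m%:R ^+ 4 * x ^+ 2 - 3 * pi * m%:R ^+ 2 * x) *
     expR (- (pi * m%:R ^+ 2 * x))).

Definition A {R : realType} (r : R) : R :=
  \int[lebesgue_measure]_(x in `]0, +oo[) (omega x * expR (- (pi * x * r ^+ 2))).

Definition c {R : realType} (n : nat) : R :=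
  2 * Num.sqrt 2 *
  \int[lebesgue_measure]_(x in `]0, +oo[)
    (omega x / (x + 1) `^ (3 / 2) * ((x - 1) / (x + 1)) ^+ n).

(* a (a - 1) ... (a - k + 1) / k! *)
Definition gbinomial {R : realType} (a : R) (k : nat) : R :=
  (\prod_(i < k) (a - i%:R)) / k`!%:R.

Definition laguerre {R : realType} (alpha : R) (n : nat) (x : R) : R :=
  \sum_(0 <= k < n.+1)
    (-1) ^+ k / k`!%:R * gbinomial (n%:R + alpha) (n - k) * x ^+ k.

Definition G3 {R : realType} (n : nat) (r : R) : R :=
  expR (- (pi * r ^+ 2)) * laguerre (1 / 2) n (2 * pi * r ^+ 2).

(* R^3 is encoded as (R * R) * R with its product Lebesgue measure. *)
Definition euclid_norm3 {R : realType} (v : R * R * R) : R :=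
  Num.sqrt (v.1.1 ^+ 2 + v.1.2 ^+ 2 + v.2 ^+ 2).

Definition radial3 {R : realType} (F : R -> R) (v : R * R * R) : R :=
  F (euclid_norm3 v).

Definition lebesgue_measure3 {R : realType} :=
  (@lebesgue_measure R \x @lebesgue_measure R \x @lebesgue_measure R)%E.

Definition L2_cvg {R : realType} d (T : measurableType d)
    (mu : {measure set T -> \bar R}) (f_ : nat -> T -> R) (f : T -> R) : Prop :=
  [/\ forall N, f_ N \in Lfun mu 2%:E,
      f \in Lfun mu 2%:E &
      ('N[mu]_2%:E[EFin \o (f \- f_ N)%R] @[N --> \oo] --> 0)%E].

(* Main.v *)
Require Import Defs.
From HB Require Import structures.
From mathcomp Require Import all_boot all_order all_algebra.
From mathcomp Require Import ring lra.
From mathcomp Require Import all_classical all_reals all_analysis measurable_realfun.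
Import Order.TTheory GRing.Theory Num.Theory.
Import numFieldNormedType.Exports.
Local Open Scope classical_set_scope.
Local Open Scope ring_scope.

(** Put z = 2 pi r^2 and t = (x - 1)/(x + 1), so that 1 - t = 2/(x + 1).  The
    generating function of the Laguerre polynomials,
      sum_n L_n^(1/2)(z) t^n = (1 - t)^(-3/2) exp(- t z/(1 - t)),
    becomes, after multiplication by exp(- pi r^2),
      2 sqrt 2 (x + 1)^(-3/2) sum_n t^n G_n(r) = exp(- pi x r^2).
    Integrating this against omega term by term is the expansion of A.  What has
    to be proved is therefore that sum and integral may be exchanged, and that
    the exchange is uniform enough for convergence in L^2.

    Three estimates do this.  They lose powers of n freely and recover them from
    the rapid decay of omega at both ends of the half-line.

    - Laguerre functions.  With u_n = exp(-z/2) L_n^a(z), one has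
      u_n' = - u_n/2 - sum_(k < n) u_k, hence
      d/dz sum_(n < N) u_n^2 = - (sum_(n < N) u_n)^2 <= 0, so that u_N^2 is at most the
      sum of the L_n(0)^2 for n <= N, and |u_n| <= (n + 1)^2 on the half-line.
      The three-term recurrence turns a factor 1 + z into a factor of order
      n + 1 (laguerre_decay), so |G_n(r)| <= B (n + 1)^4/(1 + r^2)^2 (G3_bound).

    - omega.  For x = h^2 the summands of omega are samples at the nodes h m of
      an even function g vanishing at 0 which is a derivative, g = F', of a
      polynomial times a Gaussian.  Summing F^(k+1) over all the translates of s
      by the lattice h Z gives a periodic function of s; being a derivative it
      vanishes somewhere, so that it is at most h times the supremum of the
      corresponding sum of F^(k+2).  Iterating gives omega(x) = O(x^6) at 0; at
      infinity omega(x) = O(x^-8) is clear (omega_bound).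

    - Powers of t.  Since (n + 1)^6 |t|^n is at most a constant times
      (1 - |t|)^(-6), and 1 - |t| = 2 min(x, 1)/(x + 1), the decay of omega gives
      |omega(x) t^n| <= D (n + 1)^(-6)/(1 + x^2) (omega_kernel_bound), and in
      particular c_n = O(n^-6) (c_bound).

    Dominated convergence then gives the pointwise statement (A_expansion).  The
    product of the bounds on c_n and G_n gives
      |A(r) - sum_(n < N) c_n G_n(r)| <= K/((N + 1) (1 + r^2)^2)
    (partial_sum_bounds), and (1 + r^2)^(-2) is square integrable on R^3 because
    its square is at most the product of the 1/(1 + v_i^2)
    (Lnorm2_radial3_le). *)

(** * Recurrences for the Laguerre polynomials *)

Lemma gbinomial_absorb (R : realType) (y : R) j :
  j.+1%:R * gbinomial (y + 1) j.+1 = (y + 1) * gbinomial y j.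
Proof.
rewrite /gbinomial big_ord_recl factS natrM invfM subr0.
under eq_bigr => i _ do rewrite lift0 -addn1 natrD opprD addrACA [1 - 1]subrr addr0.
field; by rewrite nat1r !pnatr_eq0 -lt0n fact_gt0.
Qed.

Lemma gbinomial_pascal (R : realType) (y : R) j :
  gbinomial (y + 1) j.+1 = gbinomial y j.+1 + gbinomial y j.
Proof.
apply: (@mulfI _ j.+1%:R); first by rewrite pnatr_eq0.
rewrite gbinomial_absorb /gbinomial big_ord_recr /= factS natrM invfM.
field; by rewrite nat1r !pnatr_eq0 -lt0n fact_gt0.
Qed.

Definition laguerre_poly {R : realType} (a : R) n : {poly R} :=
  \poly_(k < n.+1) ((-1) ^+ k / k`!%:R * gbinomial (n%:R + a) (n - k)).

Lemma laguerreE (R : realType) (a : R) n x :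
  laguerre a n x = (laguerre_poly a n).[x].
Proof. by rewrite /laguerre horner_poly big_mkord. Qed.

(** Coefficientwise this is Pascal's rule; it says that (L_n^a)' = - sum_(k < n) L_k^a. *)
Lemma deriv_laguerreS (R : realType) (a : R) n :
  (laguerre_poly a n.+1)^`() = (laguerre_poly a n)^`() - laguerre_poly a n.
Proof.
apply/polyP => k; rewrite coefB !coef_deriv !coef_poly !ltnS.
have kf : k`!%:R != 0 :> R by rewrite pnatr_eq0 -lt0n fact_gt0.
have fS : k.+1`!%:R = k.+1%:R * k`!%:R :> R by rewrite factS natrM.
have k1 : k.+1%:R != 0 :> R by rewrite pnatr_eq0.
have [kn|nk|->] := ltngtP k n.
- rewrite -[LHS]mulr_natr -[X in _ = X - _]mulr_natr subSS.
  have -> : (n - k = (n - k.+1).+1)%N by rewrite subnSK.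
  have -> : n.+1%:R + a = n%:R + a + 1 by rewrite -natr1 addrAC.
  rewrite gbinomial_pascal fS exprS; field.
  by rewrite kf nat1r k1.
- by rewrite mul0rn subr0.
- rewrite !subnn /gbinomial !big_ord0 mul0rn sub0r -mulr_natr.
  rewrite factS natrM exprS; field.
  by rewrite nat1r !pnatr_eq0 -!lt0n !fact_gt0.
Qed.

(** Coefficientwise this is the absorption identity of the binomials. *)
Lemma mulX_deriv_laguerre (R : realType) (a : R) n :
  'X * (laguerre_poly a n.+1)^`() =
  n.+1%:R *: laguerre_poly a n.+1 - (n.+1%:R + a) *: laguerre_poly a n.
Proof.
apply/polyP => k; rewrite coefXM coefB !coefZ coef_deriv !coef_poly.
have -> : (if k == 0 then 0 else
    (if (k.-1.+1 < n.+2)%N then (-1) ^+ k.-1.+1 / k.-1.+1`!%:R *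
     gbinomial (n.+1%:R + a) (n.+1 - k.-1.+1) else 0) *+ k.-1.+1) =
  (if (k < n.+2)%N then (-1) ^+ k / k`!%:R *
     gbinomial (n.+1%:R + a) (n.+1 - k) else 0) *+ k :> R.
  by case: k.
rewrite !ltnS.
have [kn|nk|->] := ltngtP k n.+1.
- rewrite ltnS in kn; rewrite kn (subSn kn).
  have -> : n.+1%:R + a = n%:R + a + 1 by rewrite -natr1 addrAC.
  have h := gbinomial_absorb R (n%:R + a) (n - k).
  have kE : k%:R = n%:R - (n - k)%:R :> R by rewrite natrB // subKr.
  rewrite -[LHS]mulr_natr kE [(n%:R + a + 1) * _]mulrCA -h -!natr1.
  ring.
- by rewrite mul0rn !mulr0 ?ifF ?mulr0 ?subrr // leqNgt (ltn_trans (ltnSn _) nk).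
- by rewrite ltnn mulr0 subr0 -mulr_natl.
Qed.

Lemma laguerre_poly0 (R : realType) (a : R) : laguerre_poly a 0 = 1.
Proof.
apply/polyP => k; rewrite coef_poly coef1; case: k => [|k]//=.
by rewrite /gbinomial big_ord0 fact0 expr0 !divr1 mulr1.
Qed.

(** Eliminating the derivatives between the two preceding identities gives the
    three-term recurrence. *)
Lemma laguerreSS (R : realType) (a z : R) n :
  n.+2%:R * laguerre a n.+2 z =
  ((2 * n%:R + 3 + a) - z) * laguerre a n.+1 z - (n%:R + 1 + a) * laguerre a n z.
Proof.
have h2 := congr1 (horner^~ z) (mulX_deriv_laguerre R a n.+1).
have h1 := congr1 (horner^~ z) (mulX_deriv_laguerre R a n).
have h0 := congr1 (horner^~ z) (deriv_laguerreS R a n.+1).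
rewrite /= !(hornerE,hornerZ) in h0 h1 h2; rewrite !laguerreE.
move: h2 h1; rewrite h0 -[n.+2%:R]natr1 -[n.+1%:R]natr1 => h2 h1.
rewrite -[LHS](subrK ((n%:R + 1 + 1 + a) * (laguerre_poly a n.+1).[z])) -h2.
by rewrite mulrBr h1; ring.
Qed.

Lemma laguerre0 (R : realType) (a z : R) : laguerre a 0 z = 1.
Proof. by rewrite laguerreE laguerre_poly0 hornerE. Qed.

Lemma laguerre1 (R : realType) (a z : R) : laguerre a 1 z = 1 + a - z.
Proof.
have /(congr1 (horner^~ z)) := mulX_deriv_laguerre R a 0.
rewrite /= deriv_laguerreS laguerreE laguerre_poly0 derivC.
rewrite !(hornerE,hornerZ) => h; lra.
Qed.

(** * Bounds on the Laguerre functions *)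

(** exp(- z) p(z) has derivative exp(- z) (p'(z) - p(z)) <= 0. *)
Lemma expRN_horner_nincr (R : realType) (p : {poly R}) :
  (forall z, 0 <= z -> p^`().[z] <= p.[z]) ->
  forall z, 0 <= z -> expR (- z) * p.[z] <= p.[0].
Proof.
move=> pp z z0.
have df x : is_derive x (1 : R) (fun z => expR (- z) * p.[z])
    (expR (- x) * (p^`().[x] - p.[x])).
  apply: is_derive_eq.
  by rewrite /GRing.scale /= mulrN1 mulrBr mulrN; congr (_ + _); rewrite mulrC.
suff : expR (- z) * p.[z] <= expR (- 0) * p.[0] by rewrite oppr0 expR0 mul1r.
apply: (@ler0_derive1_nincry _ (fun z => expR (- z) * p.[z]) 0) => //.
- move=> x; rewrite in_itv /= andbT => /ltW x0.
  by rewrite derive1E derive_val mulr_ge0_le0 ?expR_ge0// subr_le0 pp.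
- apply: continuous_subspaceT => x.
  by apply: differentiable_continuous; apply/derivable1_diffP.
Qed.

Lemma deriv_laguerre_sum (R : realType) (a : R) n :
  (laguerre_poly a n)^`() = - \sum_(k < n) laguerre_poly a k.
Proof.
elim: n => [|n ih]; first by rewrite laguerre_poly0 big_ord0 derivC oppr0.
by rewrite deriv_laguerreS ih big_ord_recr /= opprD.
Qed.

(** In the derivative of the sum of squares the cross terms 2 L_n L_k, k < n,
    are those of a perfect square, thanks to (L_n)' = - sum_(k < n) L_k. *)
Lemma deriv_sum_sqr_laguerre (R : realType) (a : R) N :
  (\sum_(n < N) laguerre_poly a n ^+ 2)^`() =
  \sum_(n < N) laguerre_poly a n ^+ 2 - (\sum_(n < N) laguerre_poly a n) ^+ 2.
Proof.
elim: N => [|N ih]; first by rewrite !big_ord0 deriv0 expr0n subrr.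
rewrite !big_ord_recr /= derivD ih !expr2 derivM deriv_laguerre_sum /=.
move: (\sum_(_ < _) _) (\sum_(_ < _) _) => S T; ring.
Qed.

(** At z = 0 the identity for z L_n' reads n L_n(0) = (n + a) L_(n-1)(0),
    so that L_n(0) grows at most like n + 1 when a <= 1. *)
Lemma laguerre_at0 (R : realType) (a : R) n : 0 <= a <= 1 ->
  0 <= laguerre a n 0 <= n.+1%:R.
Proof.
move=> a01; elim: n => [|n ih]; first by rewrite laguerre0 lexx ler01.
have /(congr1 (horner^~ 0)) := mulX_deriv_laguerre R a n.
rewrite !laguerreE in ih *.
rewrite /= !hornerE ?mul0r => h; move: ih h.
rewrite -[n.+2%:R]natr1 -[n.+1%:R]natr1; have : 0 <= n%:R :> R by [].
move: (n%:R) (_.[0]) (_.[0]) a01 => m u v a01 m0 ih h.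
have {}h : (m + 1) * v = (m + 1 + a) * u by apply/esym/eqP; rewrite -subr_eq0; lra.
have [a0 a1] := andP a01; have [u0 um] := andP ih.
have m1 : 0 < m + 1 by lra.
rewrite -(pmulr_rge0 _ m1) -(ler_pM2l m1 v) h mulr_ge0//=; last by lra.
rewrite [leRHS]mulrC ler_pM//; lra.
Qed.

(** The sum of the squares of the Laguerre functions up to n is nonincreasing in z,
    hence at most its value at 0, a sum of n + 1 terms none exceeding (n + 1)^2,
    and therefore at most (n + 1)^4. *)
Lemma laguerre_bound (R : realType) (a z : R) n : 0 <= a <= 1 -> 0 <= z ->
  `|expR (- (z / 2)) * laguerre a n z| <= n.+1%:R ^+ 2.
Proof.
move=> a01 z0; rewrite -ler_sqr ?nnegrE// -normrX ger0_norm ?sqr_ge0//.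
have ez : expR (- (z / 2)) ^+ 2 = expR (- z).
  by rewrite -expRM_natl mulrN mulrCA divff ?mulr1.
have dec y : 0 <= y -> (\sum_(k < n.+1) laguerre_poly a k ^+ 2)^`().[y] <=
    (\sum_(k < n.+1) laguerre_poly a k ^+ 2).[y].
  by move=> _; rewrite deriv_sum_sqr_laguerre hornerD hornerN gerBl horner_exp sqr_ge0.
rewrite exprMn ez; apply: (@le_trans _ _ (\sum_(k < n.+1) laguerre_poly a k ^+ 2).[0]).
  apply: le_trans (expRN_horner_nincr _ _ dec _ z0).
  rewrite ler_wpM2l ?expR_ge0// big_ord_recr /= hornerD horner_exp laguerreE lerDr.
  by rewrite horner_sum sumr_ge0 // => i _; rewrite horner_exp sqr_ge0.
rewrite horner_sum (@le_trans _ _ (\sum_(k < n.+1) n.+1%:R ^+ 2))//.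
  apply: ler_sum => i _; rewrite horner_exp -laguerreE.
  have /andP[l0 ln] := laguerre_at0 R a i a01.
  by rewrite lerXn2r ?nnegrE// (le_trans ln)// ler_nat.
rewrite sumr_const card_ord -[leLHS]mulr_natl -exprM -exprS.
by rewrite ler_weXn2l// ler1n.
Qed.

(** The three-term recurrence read as a formula for z L_n: multiplication by z costs
    one power of n. *)
Lemma mulz_laguerre_le (R : realType) (a z : R) n : 0 <= a <= 1 -> 0 <= z ->
  (1 + z) * `|laguerre a n z| <= n.+1%:R *
    (3 * `|laguerre a n z| + `|laguerre a n.+1 z| + `|laguerre a n.-1 z|).
Proof.
move=> /andP[a0 a1] z0.
have n0 : 0 <= n%:R :> R by [].
suff [b /andP[b0 bn] e] : exists2 b : R, 0 <= b <= n%:R + 1 &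
   z * laguerre a n z = (2 * n%:R + 1 + a) * laguerre a n z
    - (n%:R + 1) * laguerre a n.+1 z - b * laguerre a n.-1 z.
  rewrite mulrDl mul1r -{2}(ger0_norm z0) -normrM e -natr1.
  apply: (@le_trans _ _ (`|laguerre a n z| + ((2 * n%:R + 1 + a) * `|laguerre a n z|
    + (n%:R + 1) * `|laguerre a n.+1 z| + b * `|laguerre a n.-1 z|))).
    rewrite lerD2l; apply: le_trans (ler_normB _ _) _; apply: lerD.
      apply: le_trans (ler_normB _ _) _; apply: lerD.
        by rewrite normrM ger0_norm//; lra.
      by rewrite normrM ger0_norm//; lra.
    by rewrite normrM ger0_norm.
  have x0 := normr_ge0 (laguerre a n.-1 z); have y0 := normr_ge0 (laguerre a n z).
  have : 0 <= (n%:R + 1 - b) * `|laguerre a n.-1 z| by rewrite mulr_ge0// subr_ge0.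
  have : 0 <= (1 - a) * `|laguerre a n z| by rewrite mulr_ge0// subr_ge0.
  have : 0 <= n%:R * `|laguerre a n z| by rewrite mulr_ge0.
  lra.
case: n n0 => [|n] n0.
  by exists 0; rewrite ?lexx ?addr_ge0//= laguerre1 laguerre0; lra.
exists (n%:R + 1 + a).
  by rewrite -natr1; apply/andP; split; lra.
by have := laguerreSS R a z n; rewrite -!natr1 /= => h; lra.
Qed.

(** Induction on k, trading each factor 1 + z for a factor n + 1. *)
Lemma laguerre_decay (R : realType) (a : R) (k : nat) : 0 <= a <= 1 ->
  exists2 K, 0 <= K & forall n z, 0 <= z ->
    (1 + z) ^+ k * `|expR (- (z / 2)) * laguerre a n z| <= K * n.+1%:R ^+ (k + 2).
Proof.
move=> a01; elim: k => [|k [K K0 ih]].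
  by exists 1 => // n z z0; rewrite !mul1r laguerre_bound.
exists (K * 2 ^+ (k + 2) * 5) => [|n z z0]; first by rewrite !mulr_ge0.
pose e := (1 + z) ^+ k * expR (- (z / 2)).
have e0 : 0 <= e by rewrite mulr_ge0 ?expR_ge0 ?exprn_ge0 ?addr_ge0.
have B m : (m <= n.+1)%N -> e * `|laguerre a m z| <= K * 2 ^+ (k + 2) * n.+1%:R ^+ (k + 2).
  move=> mn; have := ih m z z0; rewrite normrM (ger0_norm (expR_ge0 _)) mulrA.
  move=> /le_trans; apply.
  rewrite -mulrA ler_wpM2l// -exprMn lerXn2r ?nnegrE//.
  by rewrite -natrM ler_nat mul2n -addnn addSn ltnS (leq_trans mn)// leq_addl.
rewrite normrM (ger0_norm (expR_ge0 _)) exprSr.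
have -> : (1 + z) ^+ k * (1 + z) * (expR (- (z / 2)) * `|laguerre a n z|) =
  e * ((1 + z) * `|laguerre a n z|) by rewrite /e; ring.
apply: le_trans (ler_wpM2l e0 (mulz_laguerre_le _ _ _ n a01 z0)) _.
have B1 := B n (leqnSn _).
have B2 := B n.+1 (leqnn _).
have B3 := B n.-1 (leq_trans (leq_pred _) (leqnSn _)).
rewrite mulrCA addSn exprS [leRHS]mulrCA ler_wpM2l//.
move: B1 B2 B3; move: (_ ^+ _) => w; move: (_ ^+ _) => v; lra.
Qed.

(** * The generating function *)

(** The quantity 'C(n + k, n) s^n (1 - s)^k is one term of the binomial expansion of
    (s + (1 - s))^(n + k) = 1. *)
Lemma expn_geometric_le (R : realType) (s : R) k n : 0 <= s <= 1 ->
  n.+1%:R ^+ k * s ^+ n * (1 - s) ^+ k <= k`!%:R.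
Proof.
move=> /andP[s0 s1]; have s1' : 0 <= 1 - s by rewrite subr_ge0.
have nk : (n.+1 ^ k <= 'C(n + k, n) * k`!)%N.
  have -> : 'C(n + k, n) = 'C(n + k, k) by rewrite -bin_sub ?leq_addr// addKn.
  rewrite bin_ffact.
  elim: k => [|k ih]; first by rewrite ffactn0.
  by rewrite addnS ffactSS expnS leq_mul// ltnS leq_addr.
have : 'C(n + k, n)%:R * (s ^+ n * (1 - s) ^+ k) <= 1.
  have e : (1 - s + s) ^+ (n + k) = 1 by rewrite subrK expr1n.
  rewrite -[leRHS]e [leRHS]exprDn.
  have nk1 : (n < (n + k).+1)%N by rewrite ltnS leq_addr.
  rewrite (bigD1 (Ordinal nk1)) //= addKn mulr_natl [s ^+ n * _]mulrC lerDl.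
  by apply: sumr_ge0 => i _; rewrite mulrn_wge0// mulr_ge0// exprn_ge0.
move=> h; rewrite -[leRHS]mul1r.
apply: le_trans (ler_wpM2r (ler0n _ _) h).
rewrite -mulrA mulrAC -natrM ler_wpM2r ?mulr_ge0 ?exprn_ge0//.
by rewrite -natrX ler_nat.
Qed.

(** Compared with a geometric series of ratio strictly between |K| and 1. *)
Lemma is_cvg_pseries_polynomial (R : realType) (c : R^nat) (B K : R) k :
  (forall n, `|c n| <= B * n.+1%:R ^+ k) -> `|K| < 1 -> cvgn (pseries c K).
Proof.
move=> cB K1; apply: normed_cvg.
have B0 : 0 <= B.
  by have := cB 0%N; rewrite expr1n mulr1; exact: le_trans.
(* The ratio s of |K| to q absorbs the polynomial factor. *)
pose q := (1 + `|K|) / 2.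
have q0 : 0 < q by rewrite divr_gt0// ltr_wpDr.
have q1 : q < 1 by rewrite /q; lra.
have Kq : `|K| < q by rewrite /q; lra.
pose s := `|K| / q.
have s1 : s < 1 by rewrite ltr_pdivrMr// mul1r.
have s0 : 0 <= s by rewrite divr_ge0// ltW.
pose D := B * k`!%:R / (1 - s) ^+ k.
have D0 : 0 <= D by rewrite !mulr_ge0// invr_ge0 exprn_ge0// subr_ge0 ltW.
apply: (@series_le_cvg _ _ (geometric D q)) => [n|n|n|] /=.
- by [].
- by rewrite mulr_ge0// exprn_ge0// ltW.
- rewrite normrM normrX.
  have -> : `|K| = s * q by rewrite mulfVK// gt_eqF.
  rewrite exprMn mulrA ler_wpM2r ?exprn_ge0 ?(ltW q0)//.
  rewrite /D ler_pdivlMr ?exprn_gt0 ?subr_gt0//.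
  apply: (@le_trans _ _ (B * (n.+1%:R ^+ k * s ^+ n * (1 - s) ^+ k))).
    by rewrite !mulrA !ler_wpM2r ?exprn_ge0 ?subr_ge0 ?(ltW s1)// cB.
  by rewrite ler_wpM2l// expn_geometric_le// s0 ltW.
- by apply: is_cvg_geometric_series; rewrite ger0_norm// ltW.
Qed.

Section generating_function.
Context {R : realType} (a z : R) (a01 : 0 <= a <= 1) (z0 : 0 <= z).

Let ell n := laguerre a n z.
Let s t N := \sum_(0 <= n < N) ell n * t ^+ n.
Let d t N := \sum_(0 <= n < N) pseries_diffs ell n * t ^+ n.

Let sS t N : s t N.+1 = s t N + ell N * t ^+ N.
Proof. by rewrite /s big_nat_recr. Qed.

Let dS t N : d t N.+1 = d t N + N.+1%:R * ell N.+1 * t ^+ N.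
Proof. by rewrite /d big_nat_recr. Qed.

(** The three-term recurrence at the level of partial sums; in the limit it is the
    differential equation (1 - t)^2 F' = (1 + a - z - (1 + a) t) F. *)
Lemma laguerre_series_rec t N :
  d t N.+2 = 2 * t * d t N.+1 + (1 + a - z) * s t N.+2
    - t * (t * d t N + (1 + a) * s t N.+1).
Proof.
elim: N => [|N ih].
  rewrite !dS !sS /d /s !big_geq// expr0 expr1.
  have := laguerreSS R a z 0; rewrite /ell laguerre0 laguerre1 => h.
  rewrite h; ring.
rewrite dS {1}ih (dS t N.+1) (sS t N.+2) (dS t N) (sS t N.+1).
have -> : N.+3%:R * ell N.+3 = (2 * N.+1%:R + 3 + a - z) * ell N.+2
   - (N.+1%:R + 1 + a) * ell N.+1 by exact: laguerreSS.
rewrite -!natr1 !exprS; ring.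
Qed.

Let ell_bound n : `|ell n| <= expR (z / 2) * n.+1%:R ^+ 2.
Proof.
have := laguerre_bound R a z n a01 z0.
by rewrite normrM expRN ger0_norm ?invr_ge0 ?expR_ge0// ler_pdivrMl ?expR_gt0.
Qed.

Let diffs_bound (f : R^nat) B k : (forall n, `|f n| <= B * n.+1%:R ^+ k) ->
  forall n, `|pseries_diffs f n| <= B * 2 ^+ k * n.+1%:R ^+ k.+1.
Proof.
move=> fB n; have B0 : 0 <= B.
  by have := fB 0%N; rewrite expr1n mulr1; exact: le_trans.
rewrite normrM ger0_norm// exprS mulrCA ler_wpM2l//.
apply: le_trans (fB _) _; rewrite -mulrA ler_wpM2l// -exprMn lerXn2r ?nnegrE//.
by rewrite -natrM ler_nat mul2n -addnn addSn ltnS leq_addl.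
Qed.

Let F (t : R) : R := limn (pseries ell t).
Let F' (t : R) : R := limn (pseries (pseries_diffs ell) t).

Let is_cvg_s t : `|t| < 1 -> cvgn (pseries ell t).
Proof. exact: is_cvg_pseries_polynomial ell_bound. Qed.

Let is_cvg_d t : `|t| < 1 -> cvgn (pseries (pseries_diffs ell) t).
Proof. exact: is_cvg_pseries_polynomial (diffs_bound _ _ _ ell_bound). Qed.

Let F_ode t : `|t| < 1 -> (1 - t) ^+ 2 * F' t = (1 + a - z - (1 + a) * t) * F t.
Proof.
move=> t1.
have sF k : s t (N + k)%N @[N --> \oo] --> F t by rewrite (cvg_shiftn k (s t)); exact: is_cvg_s.
have dF k : d t (N + k)%N @[N --> \oo] --> F' t by rewrite (cvg_shiftn k (d t)); exact: is_cvg_d.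
have h : d t (N + 2)%N @[N --> \oo] --> 2 * t * F' t + (1 + a - z) * F t
    - t * (t * F' t + (1 + a) * F t).
  have e N : d t (N + 2)%N = 2 * t * d t (N + 1)%N + (1 + a - z) * s t (N + 2)%N
      - t * (t * d t (N + 0)%N + (1 + a) * s t (N + 1)%N).
    by rewrite addn0 addn1 addn2 laguerre_series_rec.
  under eq_fun do rewrite e.
  apply: cvgB; first by apply: cvgD; apply: cvgMl_tmp.
  by apply: cvgMl_tmp; apply: cvgD; apply: cvgMl_tmp => //.
have E : 2 * t * F' t + (1 + a - z) * F t - t * (t * F' t + (1 + a) * F t) = F' t.
  exact: (cvg_unique _ h (dF 2%N)).
move: (F' t) (F t) E => x y E; lra.
Qed.

Let is_derive_F t : `|t| < 1 -> is_derive t (1 : R) F (F' t).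
Proof.
move=> t1; have t0 := normr_ge0 t; pose K := (1 + `|t|) / 2.
have K1 : `|K| < 1 by rewrite ger0_norm /K; lra.
apply: (@pseries_snd_diffs _ _ K).
- exact: is_cvg_s.
- exact: is_cvg_d.
- exact: is_cvg_pseries_polynomial (diffs_bound _ _ _ (diffs_bound _ _ _ ell_bound)) _.
- by rewrite [ltRHS]ger0_norm /K; lra.
Qed.

Let E (t : R) := expR ((1 + a) * ln (1 - t) + (z * (1 - t)^-1 - z)).

Let is_derive_E (t : R) : t < 1 ->
  is_derive t (1 : R) E (E t * (- (1 + a) / (1 - t) + z / (1 - t) ^+ 2)).
Proof.
move=> t1; have t10 : 0 < 1 - t by rewrite subr_gt0.
have d1 : is_derive t (1:R) (fun t : R => 1 - t) (- 1).
  by apply: is_derive_eq; rewrite add0r mul1r.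
have dln : is_derive t (1:R) (fun t => ln (1 - t)) ((1 - t)^-1 * - 1).
  by apply: is_derive1_comp; exact: is_derive1_ln.
have dinv := @is_deriveV R (fun t => 1 - t) t _ _ (lt0r_neq0 t10) d1.
apply: is_derive_eq.
rewrite /GRing.scale /= /E; congr (_ * _).
by field; rewrite lt0r_neq0.
Qed.

(** The generating series F solves a first order linear equation whose solutions are
    the multiples of 1/E, where E is the inverse of the expected sum: E F has
    derivative 0 on the interval (-1, 1), and is 1 at the origin. *)
Lemma laguerre_generating t : `|t| < 1 ->
  pseries (fun n => laguerre a n z) t @ \oo -->
  (1 - t) `^ (- (1 + a)) * expR (- (t * z / (1 - t))).
Proof.
move=> t1.
have tN1 : t < 1 by rewrite (le_lt_trans (ler_norm _)).
have dP x : `|x| < 1 -> is_derive x (1:R) (fun t => E t * F t) 0.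
  move=> x1; have x1' : x < 1 by rewrite (le_lt_trans (ler_norm _)).
  have dE := is_derive_E _ x1'; have dF := is_derive_F _ x1.
  apply: is_derive_eq; rewrite /GRing.scale /=.
  have ode := F_ode _ x1.
  have x0 : 1 - x != 0 by rewrite subr_eq0 gt_eqF.
  have -> : F' x = (1 + a - z - (1 + a) * x) * F x / (1 - x) ^+ 2.
    by rewrite -ode mulrAC divff ?mul1r// expf_neq0.
  by field.
have cst x y : `|x| < 1 -> `|y| < 1 -> x <= y -> E x * F x = E y * F y.
  move=> x1 y1 xy; have between u : x <= u <= y -> `|u| < 1.
    move=> /andP[xu uy]; move: x1 y1; rewrite !ltr_norml => /andP[? ?] /andP[? ?].
    by apply/andP; split; lra.
  have [u||v _] := @MVT_segment R (fun t => E t * F t) (fun=> 0) x y xy.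
  - rewrite in_itv /= => /andP[/ltW xu /ltW uy].
    by apply/dP/between; rewrite xu.
  - apply: derivable_within_continuous => u; rewrite in_itv /= => xuy.
    by have [] := dP _ (between _ xuy).
  - by rewrite mul0r => /eqP; rewrite subr_eq0 => /eqP.
have F0 : F 0 = 1.
  apply/cvg_lim => //; rewrite -(cvg_shiftn 1).
  apply: cvg_near_cst; near=> N.
  rewrite /= /pseries /series /= addn1 big_nat_recl// expr0 mulr1 /ell laguerre0.
  by rewrite big1 ?addr0// => i _; rewrite expr0n mulr0.
have E0 : E 0 = 1.
  by rewrite /E subr0 ln1 mulr0 invr1 mulr1 subrr addr0 expR0.
have EF : E t * F t = 1.
  have l01 : `|0 : R| < 1 by rewrite normr0.
  by have [t0|/ltW t0] := leP t 0; [rewrite (cst t 0)|rewrite -(cst 0 t)]; rewrite // F0 E0 mulr1.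
suff -> : (1 - t) `^ (- (1 + a)) * expR (- (t * z / (1 - t))) = F t by exact: is_cvg_s.
have -> : F t = (E t)^-1.
  have E1 : E t != 0 by rewrite lt0r_neq0// expR_gt0.
  by apply: (mulfI E1); rewrite EF mulfV.
rewrite /E -expRN /powR subr_eq0 (gt_eqF tN1) -expRD; congr expR.
by field; rewrite subr_eq0 gt_eqF.
Unshelve. all: by end_near. Qed.
End generating_function.

(** * Limits and a telescoping majorant *)

Lemma ler_cvgn (R : realType) (u v : R^nat) (a b : R) :
  u @ \oo --> a -> v @ \oo --> b -> (forall n, u n <= v n) -> a <= b.
Proof.
move=> ua vb uv.
rewrite -(cvg_lim (@Rhausdorff R) ua) -(cvg_lim (@Rhausdorff R) vb).
by apply: ler_lim; [exact: cvgP ua|exact: cvgP vb|exact: nearW].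
Qed.

Definition teles {R : realType} (n : nat) : R := (n.+1%:R * n.+2%:R)^-1.

Lemma teles_ge0 (R : realType) n : 0 <= teles n :> R.
Proof. by rewrite invr_ge0 mulr_ge0. Qed.

(** 1/((n + 1) (n + 2)) = 1/(n + 1) - 1/(n + 2). *)
Lemma sum_teles (R : realType) N M : (N <= M)%N ->
  \sum_(N <= n < M) teles n = N.+1%:R^-1 - M.+1%:R^-1 :> R.
Proof.
move=> NM; under eq_bigr => n _.
  have -> : teles n = - n.+2%:R^-1 - - n.+1%:R^-1 :> R.
    rewrite /teles -[n.+2%:R]natr1; field.
    by rewrite nat1r natr1 !pnatr_eq0.
  over.
by rewrite (telescope_sumr (fun n => - n.+1%:R^-1 : R))// opprK addrC.
Qed.

Lemma sum_teles_le (R : realType) N M : \sum_(N <= n < M) teles n <= N.+1%:R^-1 :> R.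
Proof.
have [NM|/ltnW MN] := leqP N M; last by rewrite big_geq// invr_ge0.
by rewrite sum_teles// gerBl invr_ge0.
Qed.

Lemma is_cvg_series_teles (R : realType) (D : R) : cvgn (series (fun n => D * teles n)).
Proof.
have -> : series (fun n => D * teles n) = (fun n => D * (1 - n.+1%:R^-1)).
  by apply/funext => n; rewrite /series /= -mulr_sumr sum_teles// invr1.
apply: (@cvgP _ _ (D * (1 - 0))); apply: cvgMl_tmp; apply: cvgB; first exact: cvg_cst.
exact: cvg_harmonic.
Qed.

Lemma is_cvg_series_teles_le (R : realType) (u : R^nat) (D : R) :
  (forall n, `|u n| <= D * teles n) -> cvgn (series u).
Proof.
move=> uD; apply: normed_cvg; apply: (@series_le_cvg _ _ (fun n => D * teles n)) => //.
- by move=> n; exact: normr_ge0.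
- by move=> n; apply: le_trans (normr_ge0 _) (uD n).
- exact: is_cvg_series_teles.
Qed.

Lemma sum_normr_teles_le (R : realType) (u : R^nat) (D : R) M :
  (forall n, `|u n| <= D * teles n) -> `|\sum_(0 <= n < M) u n| <= D.
Proof.
move=> uD; apply: le_trans (ler_norm_sum _ _ _) _.
have D0 : 0 <= D.
  by have := le_trans (normr_ge0 _) (uD 0%N); rewrite pmulr_lge0 ?invr_gt0 ?mulr_gt0.
apply: le_trans (ler_sum _ (fun n _ => uD n)) _.
by rewrite -mulr_sumr ler_piMr// (le_trans (sum_teles_le R 0 M))// invr1.
Qed.

Lemma invr_sqr_teles_le (R : realType) n : (n.+1%:R ^+ 2)^-1 <= 2 * teles n :> R.
Proof.
rewrite /teles -[X in X * _](invrK 2) -invfM lef_pV2 ?posrE ?mulr_gt0 ?invr_gt0 ?exprn_gt0//.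
by rewrite -[n.+2%:R]natr1 -[n.+1%:R]natr1; have : 0 <= n%:R :> R by []; nra.
Qed.

Lemma invr_1Dsqr_teles_le (R : realType) (n : nat) : (1 + n%:R ^+ 2)^-1 <= 4 * teles n :> R.
Proof.
rewrite /teles -[X in X * _](invrK 4) -invfM lef_pV2 ?posrE ?mulr_gt0 ?invr_gt0//.
rewrite -[n.+2%:R]natr1 -[n.+1%:R]natr1; have : 0 <= n%:R :> R by [].
case: n => [|n _]; first by lra.
have : 1 <= n.+1%:R :> R by rewrite ler1n.
move: (n.+1%:R) => m; nra.
Qed.

(** * Sums over lattices of a polynomial times a Gaussian *)

Lemma pown_expRN_le (R : realType) k (y : R) : 0 <= y -> y ^+ k * expR (- y) <= k`!%:R.
Proof.
move=> y0; rewrite expRN ler_pdivrMr ?expR_gt0//.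
case: k => [|k]; first by rewrite expr0 mul1r -expR0 ler_expR.
have := expR_ge1Dxn k y0 => h.
rewrite mulrC -ler_pdivrMr ?ltr0n ?fact_gt0//.
by apply: le_trans h; rewrite lerDr.
Qed.

Definition gpoly {R : realType} (p : {poly R}) (u : R) : R :=
  p.[u] * expR (- (pi * u ^+ 2)).

(** pi >= 1 lets the Gaussian be compared with exp(- (1 + u^2)), and the factor u of
    each new monomial be absorbed in one more factor 1 + u^2. *)
Lemma gpoly_decay (R : realType) (p : {poly R}) k :
  exists2 C, 0 <= C & forall u, (1 + u ^+ 2) ^+ k * `|gpoly p u| <= C.
Proof.
elim/poly_ind: p k => [|p c ih] k.
  by exists 0 => // u; rewrite /gpoly horner0 mul0r normr0 mulr0.
have [C C0 hC] := ih k.+1.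
exists (C + `|c| * (expR 1 * k`!%:R)) => [|u].
  by rewrite addr_ge0// !mulr_ge0// expR_ge0.
have u0 := sqr_ge0 u.
have v0 : 0 <= 1 + u ^+ 2 by rewrite addr_ge0.
have w0 : 0 <= (1 + u ^+ 2) ^+ k by rewrite exprn_ge0.
have -> : gpoly (p * 'X + c%:P) u = u * gpoly p u + c * expR (- (pi * u ^+ 2)).
  by rewrite /gpoly hornerMXaddC; ring.
apply: le_trans (ler_wpM2l w0 (ler_normD _ _)) _.
rewrite mulrDr; apply: lerD.
  apply: le_trans (hC u); rewrite normrM mulrA ler_wpM2r// [_ ^+ k.+1]exprSr ler_wpM2l//.
  by have [h|/ltW h] := leP 0 u; [rewrite ger0_norm//; nra|rewrite ler0_norm//; nra].
rewrite normrM (ger0_norm (expR_ge0 _)) mulrCA ler_wpM2l//.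
apply: (@le_trans _ _ ((1 + u ^+ 2) ^+ k * (expR 1 * expR (- (1 + u ^+ 2))))).
  rewrite ler_wpM2l// -expRD ler_expR.
  by have := pi_ge2 R; nra.
by rewrite mulrCA ler_wpM2l ?expR_ge0// pown_expRN_le.
Qed.

(** The differentiation of gpoly p, carried out on the polynomial factor. *)
Definition gderiv {R : realType} (p : {poly R}) : {poly R} :=
  p^`() - (2 * pi) *: ('X * p).

#[local] Instance is_derive_gpoly (R : realType) (p : {poly R}) (u : R) :
  is_derive u (1 : R) (gpoly p) (gpoly (gderiv p) u).
Proof.
have de : is_derive u (1 : R) (fun u : R => expR (- (pi * u ^+ 2)))
    (expR (- (pi * u ^+ 2)) * (- (2 * pi * u))).
  apply: is_derive_eq; rewrite /GRing.scale /=; ring.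
apply: is_derive_eq.
rewrite /gpoly /gderiv /GRing.scale /= hornerD hornerN hornerZ hornerM hornerX.
ring.
Qed.

(** The sum of gpoly p over the lattice h (s + Z), truncated to the 2 M nodes of indices
    - M, .., M - 1; pairing m with - 1 - m makes it a sum over m < M. *)
Definition periodize {R : realType} (p : {poly R}) (h : R) (M : nat) (s : R) : R :=
  \sum_(m < M) (gpoly p (h * (s + m%:R)) + gpoly p (h * (s - 1 - m%:R))).

#[local] Instance is_derive_periodize (R : realType) (p : {poly R}) h M (s : R) :
  is_derive s (1 : R) (periodize p h M) (h * periodize (gderiv p) h M s).
Proof.
elim: M => [|M ih].
  have -> : periodize p h 0 = cst 0 by apply/funext => x; rewrite /periodize big_ord0.
  by apply: is_derive_eq; rewrite /periodize big_ord0 mulr0.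
have -> : periodize p h M.+1 = fun s => periodize p h M s +
    (gpoly p (h * (s + M%:R)) + gpoly p (h * (s - 1 - M%:R))).
  by apply/funext => x; rewrite /periodize big_ord_recr.
have d1 : is_derive s (1:R) (fun s : R => h * (s + M%:R)) h.
  by apply: is_derive_eq; rewrite addr0 /GRing.scale /= mulr1.
have d2 : is_derive s (1:R) (fun s : R => h * (s - 1 - M%:R)) h.
  by apply: is_derive_eq; rewrite !subr0 /GRing.scale /= mulr1.
have d3 := @is_derive1_comp R (gpoly p) _ s _ _ (is_derive_gpoly _ _ _) d1.
have d4 := @is_derive1_comp R (gpoly p) _ s _ _ (is_derive_gpoly _ _ _) d2.
apply: is_derive_eq; rewrite /periodize big_ord_recr /=; ring.
Qed.

(** The two families of nodes h (s + m) and h (s - 1 - m), m < M, are shifted by one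
    step when s goes from 0 to 1, so only the extreme terms remain. *)
Lemma periodizeB (R : realType) (p : {poly R}) h M :
  periodize p h M 1 - periodize p h M 0 = gpoly p (h * M%:R) - gpoly p (- (h * M%:R)).
Proof.
elim: M => [|M ih].
  by rewrite /periodize !big_ord0 mulr0 oppr0 addr0 subrr.
rewrite /periodize !big_ord_recr -!/(periodize _ _ _ _) /= opprD addrACA ih.
rewrite subrr add0r !add0r -[M.+1%:R]nat1r.
by rewrite (_ : h * (-1 - M%:R) = - (h * (1 + M%:R))) ?mulrN; ring.
Qed.

Lemma MVT_unit (R : realType) (f df : R -> R) (a b : R) : a <= b ->
  (forall x, is_derive x (1 : R) f (df x)) ->
  exists2 c, a <= c <= b & f b - f a = df c * (b - a).
Proof.
move=> ab fdf.
have cf : {within `[a, b], continuous f}.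
  by apply: derivable_within_continuous => x _; have [] := fdf x.
by have [c] := MVT_segment ab (fun x _ => fdf x) cf; rewrite in_itv /=; exists c.
Qed.

(** Up to the factor h, the sum for the derivative is the derivative of the sum for p,
    whose increment over [0, 1] is a boundary term; by the mean value theorem it takes
    somewhere the value (boundary term)/h, and by the mean value theorem again it
    stays within h B of that value. *)
Lemma periodize_gderiv_le (R : realType) (p : {poly R}) h M B : 0 < h ->
  (forall s, 0 <= s <= 1 -> `|periodize (gderiv (gderiv p)) h M s| <= B) ->
  forall s, 0 <= s <= 1 -> `|periodize (gderiv p) h M s| <=
    `|gpoly p (h * M%:R) - gpoly p (- (h * M%:R))| / h + h * B.
Proof.
move=> h0 hB s s01; have [s0 s1] := andP s01.
have B0 : 0 <= B by apply: le_trans (hB 0 _); rewrite ?lexx ?ler01.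
have [c c01] := MVT_unit _ _ _ _ _ ler01 (is_derive_periodize R p h M).
have [c0 c1] := andP c01.
rewrite periodizeB subr0 mulr1 => ->.
rewrite normrM (gtr0_norm h0) mulrAC mulfV ?gt_eqF// mul1r.
suff H x y : 0 <= x -> x <= y -> y <= 1 ->
  `|periodize (gderiv p) h M y - periodize (gderiv p) h M x| <= h * B.
  rewrite -lerBlDl; apply: le_trans (lerB_dist _ _) _.
  by have [cs|/ltW sc] := leP c s; [rewrite H|rewrite distrC H].
move=> x0 xy y1.
have [d /andP[xd dy] ->] := MVT_unit _ _ _ _ _ xy (is_derive_periodize R (gderiv p) h M).
rewrite normrM normrM (gtr0_norm h0) -mulrA ler_pM2l// (ger0_norm (_ : 0 <= y - x)) ?subr_ge0//.
rewrite -[leRHS]mulr1 ler_pM// ?subr_ge0//.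
  by rewrite hB// (le_trans x0 xd) (le_trans dy).
by rewrite lerBlDr (le_trans y1)// lerDl.
Qed.

(** Comparison of gpoly p at the m-th node with the telescoping majorant; since
    h <= 1, one has 1 + (h m)^2 >= h^2 (1 + m^2). *)
Lemma gpoly_node_le (R : realType) (p : {poly R}) (C h u : R) m :
  0 < h -> h <= 1 -> (h * m%:R) ^+ 2 <= u ^+ 2 ->
  (1 + u ^+ 2) ^+ 1 * `|gpoly p u| <= C -> `|gpoly p u| <= 4 * C / h ^+ 2 * teles m.
Proof.
move=> h0 h1 hm hC.
have h20 : 0 < h ^+ 2 by rewrite exprn_gt0.
have m0 : 0 < 1 + m%:R ^+ 2 :> R by rewrite ltr_wpDr ?sqr_ge0.
have C0 : 0 <= C by apply: le_trans hC; rewrite mulr_ge0// exprn_ge0 ?addr_ge0 ?sqr_ge0.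
apply: (@le_trans _ _ (C / h ^+ 2 * (1 + m%:R ^+ 2)^-1)).
  rewrite ler_pdivlMr// ler_pdivlMr// mulrC; apply: le_trans hC.
  rewrite expr1 mulrCA [leRHS]mulrC ler_wpM2l//; apply: le_trans (lerD (lexx 1) hm).
  rewrite mulrDr mulr1 exprMn lerD2r; nra.
rewrite -[4 * C / _]mulrA -[4 * _ * _]mulrA mulrCA ler_wpM2l ?invr_1Dsqr_teles_le//.
by rewrite divr_ge0// ltW.
Qed.

Lemma periodize_bound (R : realType) (p : {poly R}) : exists2 C, 0 <= C &
  forall h M s, 0 < h -> h <= 1 -> 0 <= s <= 1 -> `|periodize p h M s| <= C / h ^+ 2.
Proof.
have [C C0 hC] := gpoly_decay R p 1; exists (8 * C); first by rewrite mulr_ge0.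
move=> h M s h0 h1 /andP[s0 s1]; rewrite /periodize -(big_mkord xpredT
  (fun m => gpoly p (h * (s + m%:R)) + gpoly p (h * (s - 1 - m%:R)))).
apply: sum_normr_teles_le => m; have m0 : 0 <= m%:R :> R by [].
have -> : 8 * C / h ^+ 2 * teles m = 4 * C / h ^+ 2 * teles m + 4 * C / h ^+ 2 * teles m.
  by field; rewrite gt_eqF.
have h20 : 0 < h ^+ 2 by rewrite exprn_gt0.
apply: le_trans (ler_normD _ _) _; apply: lerD; apply: gpoly_node_le => //.
  by rewrite !exprMn ler_pM2l//; nra.
by rewrite !exprMn ler_pM2l//; nra.
Qed.

Lemma gpoly_end_le (R : realType) (p : {poly R}) h : 0 < h -> h <= 1 ->
  exists2 D, 0 <= D & forall M,
    `|gpoly p (h * M%:R) - gpoly p (- (h * M%:R))| / h <= D / M.+1%:R.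
Proof.
move=> h0 h1; have [C C0 hC] := gpoly_decay R p 1.
have K0 : 0 <= 8 * C / h ^+ 2 by rewrite divr_ge0 ?sqr_ge0// mulr_ge0.
exists (8 * C / h ^+ 2 / h); first by rewrite divr_ge0// ltW.
move=> M; rewrite [leRHS]mulrAC ler_pM2r ?invr_gt0//.
have tM : teles M <= M.+1%:R^-1 :> R.
  by rewrite /teles invfM ler_piMr ?invr_ge0// invf_le1// ler1n.
apply: (@le_trans _ _ (8 * C / h ^+ 2 * teles M)); last first.
  by rewrite ler_wpM2l// K0.
have -> : 8 * C / h ^+ 2 * teles M = 4 * C / h ^+ 2 * teles M + 4 * C / h ^+ 2 * teles M.
  by field; rewrite gt_eqF.
apply: le_trans (ler_normB _ _) _; apply: lerD; apply: gpoly_node_le => //.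
by rewrite sqrrN.
Qed.

(** j applications of periodize_gderiv_le give the factor h^j; the boundary terms
    that accumulate are all O(1/(M + 1)) and disappear when M tends to infinity. *)
Lemma periodize_iter_le (R : realType) (h B : R) j (p : {poly R}) : 0 < h -> h <= 1 ->
  (forall M s, 0 <= s <= 1 -> `|periodize (iter j.+1 gderiv p) h M s| <= B) ->
  exists D, forall M s, 0 <= s <= 1 ->
    `|periodize (gderiv p) h M s| <= D / M.+1%:R + h ^+ j * B.
Proof.
move=> h0 h1; elim: j p => [|j ih] p hB.
  by exists 0 => M s s01; rewrite mul0r add0r mul1r; exact: hB.
have [D hD] := ih (gderiv p) (fun M s => ltac:(rewrite -iterSr; exact: hB)).
have [D' _ hD'] := gpoly_end_le R p h h0 h1.
exists (D' + h * D) => M s s01.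
apply: le_trans (periodize_gderiv_le _ _ _ _ _ h0 (hD M) s s01) _.
rewrite mulrDl exprS -addrA lerD ?hD'//.
by rewrite mulrDr mulrA mulrA.
Qed.

(** * Decay of omega at both ends of the half-line *)

(** gpoly omega_poly is the derivative of - pi u^3 exp(- pi u^2), namely
    (2 pi^2 u^4 - 3 pi u^2) exp(- pi u^2): the summand of omega at u = m sqrt x. *)
Definition omega_poly {R : realType} : {poly R} := gderiv (- pi *: 'X^3).

Lemma gpoly_omega (R : realType) (h : R) (m : nat) :
  gpoly omega_poly (h * m%:R) =
  (2 * pi ^+ 2 * m%:R ^+ 4 * (h ^+ 2) ^+ 2 - 3 * pi * m%:R ^+ 2 * h ^+ 2) *
     expR (- (pi * m%:R ^+ 2 * h ^+ 2)).
Proof.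
rewrite /gpoly /omega_poly /gderiv derivZ derivXn /=; congr (_ * expR _); last by ring.
rewrite hornerD hornerN !hornerZ hornerMn hornerXn hornerM hornerX hornerZ hornerXn; ring.
Qed.

(** The node m = 0 contributes nothing, so that the series may start there. *)
Lemma omega_sumE (R : realType) (h : R) :
  (fun N => \sum_(1 <= m < N) ((2 * pi ^+ 2 * m%:R ^+ 4 * (h ^+ 2) ^+ 2 -
     3 * pi * m%:R ^+ 2 * h ^+ 2) * expR (- (pi * m%:R ^+ 2 * h ^+ 2)))) =
  series (fun m => gpoly omega_poly (h * m%:R)).
Proof.
apply/funext => -[|n]; first by rewrite /series /= !big_geq.
rewrite /series /= [RHS]big_ltn// gpoly_omega !(expr0n,mulr0,mul0r) /=.
rewrite !(mul0r, subr0, add0r).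
by apply: eq_bigr => m _; rewrite gpoly_omega.
Qed.

Lemma omegaE (R : realType) (h : R) :
  omega (h ^+ 2) = limn (series (fun m => gpoly omega_poly (h * m%:R))).
Proof. by rewrite -omega_sumE. Qed.

Lemma gpoly_omega0 (R : realType) : gpoly omega_poly 0 = 0 :> R.
Proof. by have := gpoly_omega R 0 0; rewrite mulr0 => ->; ring. Qed.

Lemma gpoly_omegaN (R : realType) (u : R) : gpoly omega_poly (- u) = gpoly omega_poly u.
Proof.
by have := gpoly_omega R (- u) 1; have := gpoly_omega R u 1; rewrite !mulr1 => -> ->; rewrite sqrrN.
Qed.

(** At s = 0 the nodes are h m and - h (m + 1): by evenness each is counted twice,
    except for the origin, where the function vanishes, and for the last one. *)
Lemma periodize_omega0 (R : realType) (h : R) M :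
  periodize omega_poly h M 0 =
  2 * series (fun m => gpoly omega_poly (h * m%:R)) M + gpoly omega_poly (h * M%:R).
Proof.
rewrite /periodize /series /=; elim: M => [|M ih].
  by rewrite big_ord0 big_geq// mulr0 mulr0 gpoly_omega0 addr0.
rewrite big_ord_recr /= ih big_nat_recr//= !add0r.
have -> : h * (- 1 - M%:R) = - (h * M.+1%:R) by rewrite -natr1; ring.
rewrite gpoly_omegaN; ring.
Qed.

Lemma is_cvg_series_gpoly (R : realType) (p : {poly R}) (h : R) : 0 < h ->
  cvgn (series (fun m => gpoly p (h * m%:R))).
Proof.
move=> h0; have [C C0 hC] := gpoly_decay R p 1.
have [h1|/ltW h1] := leP h 1.
  by apply: (is_cvg_series_teles_le _ _ (4 * C / h ^+ 2)) => m; apply: gpoly_node_le.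
apply: (is_cvg_series_teles_le _ _ (4 * C / 1 ^+ 2)) => m; apply: gpoly_node_le => //.
by rewrite mul1r exprMn ler_peMl ?sqr_ge0// expr_ge1// ltW.
Qed.

(** The exponent 12 = 14 - 2 yields x^6 for x = h^2: fourteen derivatives give h^14, and
    the uniform bound on the periodization of the last one costs h^(-2).  The other
    terms tend to 0 as the truncation M grows. *)
Lemma omega_small_h (R : realType) : exists2 C : R, 0 <= C &
  forall h, 0 < h -> h <= 1 -> `|omega (h ^+ 2)| <= C * h ^+ 12.
Proof.
have [C C0 hC] := periodize_bound R (iter 15 gderiv (- pi *: 'X^3)).
exists C => // h h0 h1.
have [D hD] := periodize_iter_le R h (C / h ^+ 2) 14 (- pi *: 'X^3) h0 h1
  (fun M s s01 => hC h M s h0 h1 s01).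
have -> : C * h ^+ 12 = h ^+ 14 * (C / h ^+ 2).
  by field; rewrite gt_eqF.
set B := h ^+ 14 * _ in hD *.
pose S := series (fun m => gpoly omega_poly (h * m%:R)).
have Scvg : S @ \oo --> omega (h ^+ 2) by rewrite omegaE; exact: is_cvg_series_gpoly.
have [E E0 hE] := gpoly_end_le R omega_poly h h0 h1.
have [K K0 hK] := gpoly_decay R omega_poly 1.
suff : 2 * `|omega (h ^+ 2)| <= B.
  by have := normr_ge0 (omega (h ^+ 2)); lra.
apply: (@ler_cvgn _ (fun M => 2 * `|S M|)
    (fun M => (D + 4 * K / h ^+ 2) * M.+1%:R^-1 + B)).
- by apply: cvgMl_tmp; apply: cvg_norm.
- rewrite -[B in X in _ --> X]add0r; apply: cvgD; last exact: cvg_cst.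
  by rewrite -[0](mulr0 (D + 4 * K / h ^+ 2)); apply: cvgMl_tmp; exact: cvg_harmonic.
- move=> M; have := hD M 0; rewrite lexx ler01 => /(_ isT).
  rewrite -/omega_poly periodize_omega0 -/(S M) => hM.
  have {}hM : `|2 * S M| <= D / M.+1%:R + B + `|gpoly omega_poly (h * M%:R)|.
    rewrite -[2 * S M](addrK (gpoly omega_poly (h * M%:R))).
    by apply: le_trans (ler_normB _ _) _; rewrite lerD2r.
  rewrite normrM ger0_norm// in hM; apply: le_trans hM _.
  rewrite mulrDl addrAC lerD2r lerD2l.
  apply: (le_trans (gpoly_node_le _ _ K h _ M h0 h1 (lexx _) (hK _))).
  rewrite ler_wpM2l ?divr_ge0 ?sqr_ge0 ?mulr_ge0//.
  by rewrite /teles invfM ler_piMr ?invr_ge0// invf_le1// ler1n.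
Qed.

(** For h >= 1 and m >= 1 one has (1 + (h m)^2)^9 >= h^16 (1 + m^2). *)
Lemma omega_large_h (R : realType) : exists2 C : R, 0 <= C &
  forall h, 1 <= h -> `|omega (h ^+ 2)| <= C / h ^+ 16.
Proof.
have [C C0 hC] := gpoly_decay R omega_poly 9.
exists (4 * C) => [|h h1]; first by rewrite mulr_ge0.
have h0 : 0 < h by apply: lt_le_trans h1.
pose S := series (fun m => gpoly omega_poly (h * m%:R)).
have Scvg : S @ \oo --> omega (h ^+ 2) by rewrite omegaE; exact: is_cvg_series_gpoly.
apply: (@ler_cvgn _ (fun M => `|S M|) (fun=> 4 * C / h ^+ 16)).
- exact: cvg_norm.
- exact: cvg_cst.
- move=> M; apply: sum_normr_teles_le => -[|m].
    rewrite mulr0 gpoly_omega0 normr0 mulr_ge0 ?teles_ge0//.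
    by rewrite divr_ge0 ?exprn_ge0 ?(ltW h0)// mulr_ge0.
  have h16 : 0 < h ^+ 16 by rewrite exprn_gt0.
  apply: (@le_trans _ _ (C / h ^+ 16 * (1 + m.+1%:R ^+ 2)^-1)); last first.
    rewrite -[4 * C / _]mulrA -[4 * _ * _]mulrA mulrCA ler_wpM2l ?invr_1Dsqr_teles_le//.
    by rewrite divr_ge0// ltW.
  have m0 : 1 <= m.+1%:R :> R by rewrite ler1n.
  rewrite ler_pdivlMr ?ltr_wpDr ?sqr_ge0// ler_pdivlMr// mulrC.
  apply: le_trans (hC (h * m.+1%:R)); rewrite mulrCA [leRHS]mulrC ler_wpM2l//.
  have -> : h ^+ 16 = (h ^+ 2) ^+ 8 by rewrite -exprM.
  rewrite [_ ^+ 9]exprSr ler_pM ?exprn_ge0 ?addr_ge0 ?sqr_ge0 ?(ltW h0)//.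
    rewrite lerXn2r ?nnegrE ?addr_ge0 ?sqr_ge0// exprMn.
    have := sqr_ge0 h; move: (h ^+ 2) => H H0; nra.
  by rewrite lerD2l exprMn ler_peMl ?sqr_ge0// exprn_ege1.
Qed.

Lemma omega_bound (R : realType) : exists2 C : R, 0 <= C & forall x : R, 0 < x ->
  (x <= 1 -> `|omega x| <= C * x ^+ 6) /\ (1 <= x -> `|omega x| <= C / x ^+ 8).
Proof.
have [C C0 hC] := omega_small_h R; have [D D0 hD] := omega_large_h R.
exists (C + D) => [|x x0]; first exact: addr_ge0.
rewrite -[x](sqr_sqrtr (ltW x0)).
have s0 : 0 < Num.sqrt x by rewrite sqrtr_gt0.
split=> h.
  rewrite -exprM; apply: le_trans (hC _ s0 _) _.
    by rewrite -(@ler_pXn2r _ 2) ?nnegrE ?(ltW s0)// expr1n.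
  by rewrite ler_wpM2r ?exprn_ge0 ?(ltW s0)// lerDl.
rewrite -exprM; apply: le_trans (hD _ _) _.
  by rewrite -(@ler_pXn2r _ 2) ?nnegrE ?(ltW s0)// expr1n.
by rewrite ler_wpM2r ?invr_ge0 ?exprn_ge0 ?(ltW s0)// lerDr.
Qed.

Lemma omega_cvg (R : realType) (x : R) : 0 < x ->
  \sum_(1 <= m < N) ((2 * pi ^+ 2 * m%:R ^+ 4 * x ^+ 2 - 3 * pi * m%:R ^+ 2 * x) *
    expR (- (pi * m%:R ^+ 2 * x))) @[N --> \oo] --> omega x.
Proof.
move=> x0; rewrite -[x](sqr_sqrtr (ltW x0)) omega_sumE omegaE.
by apply: is_cvg_series_gpoly; rewrite sqrtr_gt0.
Qed.

(** * The integrands of the coefficients *)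

Lemma dominated_Rintegral (R : realType) d (T : measurableType d)
    (mu : {measure set T -> \bar R}) (D : set T) (f_ : (T -> R)^nat) (f g : T -> R) :
  measurable D -> (forall n, measurable_fun D (f_ n)) ->
  (forall x, D x -> f_ ^~ x @ \oo --> f x) ->
  mu.-integrable D (EFin \o g) ->
  (forall n x, D x -> `|f_ n x| <= g x) ->
  \int[mu]_(x in D) f_ n x @[n --> \oo] --> \int[mu]_(x in D) f x.
Proof.
move=> mD mf_ f_f ig f_g.
have mf : measurable_fun D f by exact: measurable_fun_cvg mf_ f_f.
have [] := @dominated_convergence _ _ _ mu D mD (fun n => EFin \o f_ n) (EFin \o f)
  (EFin \o g).
- by move=> n; exact/measurable_EFinP.
- exact/measurable_EFinP.
- by apply: aeW => x Dx; apply: cvg_EFin; [exact: nearW|exact: f_f].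
- exact: ig.
- by apply: aeW => x n Dx; rewrite lee_fin f_g.
move=> intf _ h; apply: (@fine_cvg _ _ _ _ (fun n => (\int[mu]_(x in D) (f_ n x)%:E)%E)).
by rewrite /Rintegral fineK//; exact: integrable_fin_num.
Qed.

Lemma integrable_oneDsqrV (R : realType) (c : R) :
  (@lebesgue_measure R).-integrable `]0, +oo[ (EFin \o (fun x => c / (1 + x ^+ 2))).
Proof.
suff H : (@lebesgue_measure R).-integrable `[0, +oo[ (EFin \o (fun x => c / (1 + x ^+ 2))).
  by apply: integrableS H => //; apply: subset_itvr; rewrite bnd_simp.
suff H : (@lebesgue_measure R).-integrable `[(0:R), +oo[ (fun x => (oneDsqr x)^-1%:E).
  have := (fun mD => @integrableZl _ _ _ (@lebesgue_measure R) _ mD c _ H) (@measurable_itv R _).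
  by apply: eq_integrable => // x _; rewrite /= -EFinM.
have m1 : measurable_fun `[(0:R), +oo[ (fun x : R => (oneDsqr x)^-1%:E).
  apply/measurable_EFinP; apply: measurable_funTS.
  by apply: continuous_measurable_fun; exact: continuous_oneDsqrV.
apply/integrableP; split => //.
under eq_integral do rewrite gee0_abs ?lee_fin ?invr_ge0 ?(le_trans ler01 (oneDsqr_ge1 _))//.
by rewrite integral0y_oneDsqr ltry.
Qed.

Lemma measurable_omega (R : realType) : measurable_fun `](0:R), +oo[ (@omega R).
Proof.
apply: (@measurable_fun_cvg _ _ R `](0:R), +oo[ (fun N (x : R) => \sum_(1 <= m < N)
  ((2 * pi ^+ 2 * m%:R ^+ 4 * x ^+ 2 - 3 * pi * m%:R ^+ 2 * x) *
    expR (- (pi * m%:R ^+ 2 * x))))).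
  move=> N; apply: measurable_sum => m; apply: measurable_funM.
    apply: measurable_funB; last exact: measurable_funM.
    by apply: measurable_funM => //; exact: measurable_funX.
  by apply: measurableT_comp => //; apply: measurableT_comp => //; exact: measurable_funM.
by move=> x /=; rewrite in_itv /= andbT => x0; exact: omega_cvg.
Qed.

Definition omega_kernel {R : realType} (n : nat) (x : R) : R :=
  omega x / (x + 1) `^ (3 / 2) * ((x - 1) / (x + 1)) ^+ n.

Lemma measurable_omega_kernel (R : realType) n : measurable_fun `](0:R), +oo[ (@omega_kernel R n).
Proof.
have mp q : measurable_fun `](0:R), +oo[ (fun x : R => (x + 1) `^ q).
  apply: (measurableT_comp (measurable_powR _)) => //.
  exact: measurable_funD.
apply: (eq_measurable_fun (fun x : R => omega x * (x + 1) `^ (- (3 / 2)) *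
    ((x - 1) * (x + 1) `^ (-1)) ^+ n)).
  move=> x; rewrite inE /= in_itv /= andbT => x0.
  by rewrite /omega_kernel powRN powR_inv1// addr_ge0// ltW.
apply: measurable_funM; first by apply: measurable_funM => //; exact: measurable_omega.
apply: measurable_funX; apply: measurable_funM => //.
exact: measurable_funB.
Qed.

(** With t = (x - 1)/(x + 1), the factor (1 - |t|)^(-6) that dominates (n + 1)^6 |t|^n is
    of order x^(-6) at 0, where the x^6 of omega compensates it, and of order x^6 at
    infinity, where the x^(-8) of omega leaves x^(-2). *)
Lemma omega_kernel_bound (R : realType) : exists2 D : R, 0 <= D & forall x n, 0 < x ->
  `|omega_kernel n x| <= D / n.+1%:R ^+ 6 / (1 + x ^+ 2).
Proof.
have [C C0 hC] := omega_bound R.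
have [K K0 hK] : exists2 K : R, 0 <= K & forall s n, 0 <= s <= 1 ->
    n.+1%:R ^+ 6 * s ^+ n * (1 - s) ^+ 6 <= K.
  by exists 6`!%:R => [|s n s01]; [exact: ler0n|exact: expn_geometric_le].
exists (2 * K * C) => [|x n x0]; first by rewrite !mulr_ge0.
have [hs hl] := hC x x0.
have x1 : 0 < x + 1 by rewrite addr_gt0.
have xx : 0 < 1 + x ^+ 2 by rewrite ltr_wpDr ?sqr_ge0.
have n6 : 0 < n.+1%:R ^+ 6 :> R by rewrite exprn_gt0.
have px : 1 <= (x + 1) `^ (3 / 2).
  rewrite -[leLHS](powRr0 (x + 1)) ler_powR//.
  by rewrite lerDr ltW.
set s := `|(x - 1) / (x + 1)|.
suff H : `|omega x| * (n.+1%:R ^+ 6 * s ^+ n) <= 2 * K * C / (1 + x ^+ 2).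
  rewrite mulrAC ler_pdivlMr//; apply: le_trans H.
  rewrite /omega_kernel normrM normrX -/s -mulrA [s ^+ n * _]mulrC.
  rewrite ler_wpM2r ?mulr_ge0 ?exprn_ge0 ?normr_ge0//.
  rewrite normrM normfV (ger0_norm (powR_ge0 _ _)) ler_piMr//.
  by rewrite invf_le1// (lt_le_trans ltr01).
(* m stands for min(x, 1). *)
have key (m : R) : 0 < m -> 1 - s = 2 * m / (x + 1) ->
    n.+1%:R ^+ 6 * s ^+ n <= K * ((x + 1) / (2 * m)) ^+ 6.
  move=> m0 e.
  have s01 : 0 <= s <= 1.
    rewrite normr_ge0 -subr_ge0 e divr_ge0 ?ltW// mulr_gt0//.
  have := hK s n s01.
  rewrite e -ler_pdivlMr ?exprn_gt0 ?divr_gt0 ?mulr_gt0// => /le_trans; apply.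
  by rewrite -exprVn invf_div.
have [x1'|/ltW x1'] := leP x 1.
  have /key h : 0 < x by [].
  apply: (@le_trans _ _ (C * x ^+ 6 * (K * ((x + 1) / (2 * x)) ^+ 6))).
    apply: ler_pM => //; [by rewrite mulr_ge0 ?exprn_ge0 ?normr_ge0| exact: hs|apply: h].
    rewrite /s normrM (ler0_norm (_ : x - 1 <= 0)) ?subr_le0// gtr0_norm ?invr_gt0//.
    by field; rewrite gt_eqF.
  have -> : C * x ^+ 6 * (K * ((x + 1) / (2 * x)) ^+ 6) = K * C * ((x + 1) / 2) ^+ 6.
    by field; rewrite gt_eqF.
  rewrite ler_pdivlMr//.
  have a1 : ((x + 1) / 2) ^+ 6 <= 1 by apply: exprn_ile1; lra.
  have a0 : 0 <= ((x + 1) / 2) ^+ 6 by apply: exprn_ge0; lra.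
  have x2 : 1 + x ^+ 2 <= 2 by nra.
  rewrite (_ : 2 * K * C = K * C * 2); last by ring.
  rewrite -[leLHS]mulrA ler_wpM2l ?mulr_ge0// -[leRHS]mul1r.
  by apply: ler_pM => //; exact: ltW.
have /key h : (0 < 1 :> R) by [].
apply: (@le_trans _ _ (C / x ^+ 8 * (K * ((x + 1) / (2 * 1)) ^+ 6))).
  apply: ler_pM => //; [by rewrite mulr_ge0 ?exprn_ge0 ?normr_ge0| exact: hl|apply: h].
  rewrite /s normrM (ger0_norm (_ : 0 <= x - 1)) ?subr_ge0// gtr0_norm ?invr_gt0//.
  by field; rewrite gt_eqF.
apply: (@le_trans _ _ (C / x ^+ 8 * (K * x ^+ 6))).
  rewrite ler_wpM2l ?divr_ge0 ?exprn_ge0 ?(ltW x0)// ler_wpM2l// lerXn2r ?nnegrE//; lra.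
rewrite (_ : C / x ^+ 8 * (K * x ^+ 6) = K * C / x ^+ 2); last by field; rewrite gt_eqF.
rewrite ler_pdivrMr ?exprn_gt0// mulrAC ler_pdivlMr//.
rewrite (_ : 2 * K * C * x ^+ 2 = K * C * (x ^+ 2 + x ^+ 2)); last by ring.
rewrite ler_wpM2l ?mulr_ge0// lerD2r exprn_ege1//.
Qed.

Lemma integrable_omega_kernel (R : realType) n :
  (@lebesgue_measure R).-integrable `]0, +oo[ (EFin \o omega_kernel n).
Proof.
have [D D0 hD] := omega_kernel_bound R.
have ig := integrable_oneDsqrV R (D / n.+1%:R ^+ 6).
apply: le_integrable ig => //.
  by apply/measurable_EFinP; exact: measurable_omega_kernel.
move=> x; rewrite /= in_itv /= andbT => x0.
by rewrite lee_fin (le_trans (hD x n x0))// ler_norm.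
Qed.

Lemma c_bound (R : realType) : exists2 E : R, 0 <= E & forall n, `|c n| <= E / n.+1%:R ^+ 6.
Proof.
have [D D0 hD] := omega_kernel_bound R.
pose I : R := \int[lebesgue_measure]_(x in `]0, +oo[) (1 / (1 + x ^+ 2)).
have I0 : 0 <= I.
  by apply: Rintegral_ge0 => x _; rewrite divr_ge0// addr_ge0// sqr_ge0.
exists (2 * Num.sqrt 2 * (D * I)) => [|n]; first by rewrite !mulr_ge0// sqrtr_ge0.
have s20 : 0 <= 2 * Num.sqrt 2 :> R by rewrite mulr_ge0// sqrtr_ge0.
rewrite /c normrM (ger0_norm s20) -[leRHS]mulrA ler_wpM2l//.
apply: (@le_trans _ _ (\int[lebesgue_measure]_(x in `]0, +oo[) `|omega_kernel n x|)).
  by apply: le_normr_Rintegral => //; exact: integrable_omega_kernel.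
rewrite mulrAC /I -RintegralZl//; last exact: integrable_oneDsqrV.
apply: le_Rintegral => //.
- exact: integrable_norm (integrable_omega_kernel R n).
- have := integrable_oneDsqrV R (D / n.+1%:R ^+ 6).
  by apply: eq_integrable => // x _ /=; rewrite mul1r.
- by move=> x; rewrite /= in_itv /= andbT mul1r => x0; exact: hD.
Qed.

(** * Pointwise convergence *)

Lemma half_itv01 (R : realType) : 0 <= (1 / 2 : R) <= 1.
Proof. by apply/andP; split; lra. Qed.

(** Since r^2 <= 2 pi r^2 = z, the power of 1 + r^2 is dominated by that of 1 + z. *)
Lemma G3_bound (R : realType) : exists2 B : R, 0 <= B & forall n r,
  (1 + r ^+ 2) ^+ 2 * `|G3 n r| <= B * n.+1%:R ^+ 4.
Proof.
have a01 := half_itv01 R.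
have [B B0 hB] := laguerre_decay R (1 / 2) 2 a01.
exists B => // n r; have r0 := sqr_ge0 r; have p2 := pi_ge2 R.
have z0 : 0 <= 2 * pi * r ^+ 2 :> R by rewrite mulr_ge0 ?sqr_ge0 ?mulr_ge0 ?pi_ge0.
apply: le_trans (hB n _ z0); rewrite /G3.
have -> : 2 * pi * r ^+ 2 / 2 = pi * r ^+ 2 :> R by field.
rewrite ler_wpM2r// lerXn2r ?nnegrE ?addr_ge0// lerD2l; nra.
Qed.

(** The generating function at t = (x - 1)/(x + 1), where 1 - t = 2/(x + 1): the
    constant 2 sqrt 2 = 2^(3/2) cancels the power of 2 of (1 - t)^(-3/2). *)
Lemma omega_kernel_generating (R : realType) (x r : R) : 0 < x ->
  \sum_(0 <= n < N) (2 * Num.sqrt 2 * omega_kernel n x * G3 n r) @[N --> \oo] -->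
  omega x * expR (- (pi * x * r ^+ 2)).
Proof.
move=> x0; have x1 : 0 < x + 1 by rewrite addr_gt0.
pose t := (x - 1) / (x + 1); pose z := 2 * pi * r ^+ 2.
have a01 := half_itv01 R.
have z0 : 0 <= z by rewrite mulr_ge0 ?sqr_ge0 ?mulr_ge0 ?pi_ge0.
have t1 : `|t| < 1.
  rewrite normrM normfV (gtr0_norm x1) ltr_pdivrMr// mul1r ltr_norml; apply/andP; split; lra.
have h := laguerre_generating (1 / 2) z a01 z0 t t1.
pose w := 2 * Num.sqrt 2 * (omega x / (x + 1) `^ (3 / 2)) * expR (- (pi * r ^+ 2)).
have -> : (fun N => \sum_(0 <= n < N) (2 * Num.sqrt 2 * omega_kernel n x * G3 n r)) =
    (fun N => w * pseries (fun n => laguerre (1 / 2) n z) t N).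
  apply/funext => N; rewrite /pseries /series /= mulr_sumr; apply: eq_bigr => n _.
  by rewrite /omega_kernel /G3 /w -/t -/z; ring.
suff -> : omega x * expR (- (pi * x * r ^+ 2)) =
    w * ((1 - t) `^ (- (1 + 1 / 2)) * expR (- (t * z / (1 - t)))) by exact: cvgMl_tmp.
have t2 : 1 - t = 2 / (x + 1) by rewrite /t; field; rewrite gt_eqF.
have -> : (1 - t) `^ (- (1 + 1 / 2)) = (x + 1) `^ (3 / 2) / (2 * Num.sqrt 2).
  have -> : 1 + 1 / 2 = 3 / 2 :> R by field.
  rewrite t2 powRN powRM ?invr_ge0 ?(ltW x1)//.
  rewrite -[(x + 1)^-1]powR_inv1 ?(ltW x1)// -powRrM mulN1r powRN invfM invrK mulrC.
  congr (_ * _^-1).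
  have -> : 3 / 2 = 1 + 2^-1 :> R by field.
  by rewrite powRD ?powRr1// ?powR12_sqrt// pnatr_eq0 implybT.
have -> : expR (- (pi * x * r ^+ 2)) = expR (- (pi * r ^+ 2)) * expR (- (t * z / (1 - t))).
  rewrite -expRD; congr expR; rewrite t2 /t /z; field; by rewrite gt_eqF.
rewrite /w; field.
by rewrite sqrtr_eq0 -ltNge ltr0n /= gt_eqF// powR_gt0.
Qed.

(** Termwise integration is justified by dominated convergence: each term is at most
    a constant times 1/((n + 1)^2 (1 + x^2)).  The origin r = 0 is included, so that A is
    everywhere a limit of continuous functions, hence measurable. *)
Lemma A_expansion (R : realType) (r : R) :
  (\sum_(0 <= n < N) c n * G3 n r) @[N --> \oo] --> A r.
Proof.
have [D D0 hD] := omega_kernel_bound R; have [B B0 hB] := G3_bound R.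
have s20 : 0 <= 2 * Num.sqrt 2 :> R by rewrite mulr_ge0// sqrtr_ge0.
have mD : measurable `](0:R), +oo[ by exact: measurable_itv.
pose k n x : R := 2 * Num.sqrt 2 * omega_kernel n x * G3 n r.
have mk n : measurable_fun `](0:R), +oo[ (k n).
  by do 2 apply: measurable_funM => //; exact: measurable_omega_kernel.
have ik n : (@lebesgue_measure R).-integrable `]0, +oo[ (EFin \o k n).
  have := (fun mD => @integrableZl _ _ _ (@lebesgue_measure R) _ mD (2 * Num.sqrt 2 * G3 n r)
    _ (integrable_omega_kernel R n)) (@measurable_itv R _).
  by apply: eq_integrable => // x _; rewrite /= -EFinM /k mulrAC.
have cE n : c n * G3 n r = \int[lebesgue_measure]_(x in `]0, +oo[) k n x.
  rewrite /c mulrAC -RintegralZl//; last exact: integrable_omega_kernel.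
  by apply: eq_Rintegral => x _; rewrite /k mulrAC.
have -> : (fun N => \sum_(0 <= n < N) c n * G3 n r) =
    (fun N => \int[lebesgue_measure]_(x in `]0, +oo[) (\sum_(0 <= n < N) k n x)).
  apply/funext; elim => [|N ih].
    rewrite big_geq// /Rintegral; under eq_integral do rewrite big_geq//.
    by rewrite integral0.
  rewrite big_nat_recr//= ih cE -RintegralD//.
    by apply: eq_Rintegral => x _; rewrite big_nat_recr.
  have := (fun mD => @integrable_sum _ _ _ (@lebesgue_measure R) _ mD _ (index_iota 0 N) xpredT
    (fun n => EFin \o k n) (fun n _ => ik n)) (@measurable_itv R _).
  by apply: eq_integrable => // x _; rewrite /= sumEFin.
rewrite /A; apply: (dominated_Rintegral _ _ _ lebesgue_measure _ _ _
  (fun x => (2 * Num.sqrt 2 * D * B * 2) / (1 + x ^+ 2))).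
- exact: mD.
- by move=> N; apply: measurable_sum.
- by move=> x; rewrite /= in_itv /= andbT => x0; exact: omega_kernel_generating.
- exact: integrable_oneDsqrV.
- move=> N x; rewrite /= in_itv /= andbT => x0; apply: sum_normr_teles_le => n.
  have xx : 0 < 1 + x ^+ 2 by rewrite ltr_wpDr ?sqr_ge0.
  have gn : `|G3 n r| <= B * n.+1%:R ^+ 4.
    by apply: le_trans (hB n r); rewrite ler_peMl// exprn_ege1// lerDl sqr_ge0.
  rewrite /= /k normrM normrM (ger0_norm s20).
  apply: (@le_trans _ _ (2 * Num.sqrt 2 * (D / n.+1%:R ^+ 6 / (1 + x ^+ 2)) * (B * n.+1%:R ^+ 4))).
    by apply: ler_pM => //; rewrite ?mulr_ge0 ?ler_wpM2l// hD.
  have -> : 2 * Num.sqrt 2 * (D / n.+1%:R ^+ 6 / (1 + x ^+ 2)) * (B * n.+1%:R ^+ 4) =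
     (2 * Num.sqrt 2 * D * B) / (1 + x ^+ 2) * (n.+1%:R ^+ 2)^-1.
    by field; rewrite nat1r pnatr_eq0 (gt_eqF xx).
  apply: (le_trans (ler_wpM2l _ (invr_sqr_teles_le R n))).
    by rewrite divr_ge0 ?(ltW xx)// !mulr_ge0.
  by rewrite le_eqVlt; apply/orP; left; apply/eqP; field; rewrite (gt_eqF xx).
Qed.

(** * Convergence in the mean square sense *)

Lemma integral_prodM (R : realType) d1 d2 (T1 : measurableType d1) (T2 : measurableType d2)
    (m1 : {sigma_finite_measure set T1 -> \bar R})
    (m2 : {sigma_finite_measure set T2 -> \bar R}) (f : T1 -> R) (g : T2 -> R) :
  measurable_fun setT f -> measurable_fun setT g ->
  (forall x, 0 <= f x) -> (forall y, 0 <= g y) ->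
  (\int[m1 \x m2]_v (f v.1 * g v.2)%:E = \int[m1]_x (f x)%:E * \int[m2]_y (g y)%:E)%E.
Proof.
move=> mf mg f0 g0.
rewrite fubini_tonelli1; last first.
- by move=> v; rewrite lee_fin mulr_ge0.
- apply/measurable_EFinP; apply: measurable_funM.
    by apply: measurableT_comp => //; exact: measurable_fst.
  by apply: measurableT_comp => //; exact: measurable_snd.
rewrite /fubini_F /=.
under eq_integral.
  move=> x _; under eq_integral do rewrite EFinM.
  rewrite ge0_integralZl_EFin//.
  - over.
  - by move=> y _; rewrite lee_fin.
  - exact/measurable_EFinP.
rewrite ge0_integralZr//.
- exact/measurable_EFinP.
- by move=> x _; rewrite lee_fin.
- by apply: integral_ge0 => y _; rewrite lee_fin.
Qed.

(** The products of the sets of two countable covers, enumerated through a pairing of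
    nat with nat * nat. *)
Lemma product_measure1_sigma_finite (R : realType) d1 d2 (T1 : measurableType d1)
    (T2 : measurableType d2) (m1 : {sigma_finite_measure set T1 -> \bar R})
    (m2 : {sigma_finite_measure set T2 -> \bar R}) : sigma_finite setT (m1 \x m2)%E.
Proof.
have [F TF Foo] := sigma_finiteT m1; have [G TG Goo] := sigma_finiteT m2.
pose H n := if unpickle n is Some (i, j) then F i `*` G j else set0.
exists H => [|n].
  apply/esym; rewrite -subTset => -[x y] _.
  have [i _ Fix] : (\bigcup_i F i) x by rewrite -TF.
  have [j _ Gjy] : (\bigcup_j G j) y by rewrite -TG.
  by exists (pickle (i, j)) => //; rewrite /H pickleK.
rewrite /H; case: unpickle => [[i j]|]; last by rewrite measure0.
have [mF Fi] := Foo i; have [mG Gj] := Goo j; split; first exact: measurableX.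
by rewrite product_measure1E// lte_mul_pinfty// ge0_fin_numE.
Qed.

Lemma integral_prodM3 (R : realType) d1 d2 d3 (T1 : measurableType d1)
    (T2 : measurableType d2) (T3 : measurableType d3)
    (m1 : {sigma_finite_measure set T1 -> \bar R})
    (m2 : {sigma_finite_measure set T2 -> \bar R})
    (m3 : {sigma_finite_measure set T3 -> \bar R}) (f : T1 -> R) (g : T2 -> R) (h : T3 -> R) :
  measurable_fun setT f -> measurable_fun setT g -> measurable_fun setT h ->
  (forall x, 0 <= f x) -> (forall y, 0 <= g y) -> (forall z, 0 <= h z) ->
  (\int[m1 \x m2 \x m3]_v (f v.1.1 * g v.1.2 * h v.2)%:E =
   \int[m1]_x (f x)%:E * \int[m2]_y (g y)%:E * \int[m3]_z (h z)%:E)%E.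
Proof.
move=> mf mg mh f0 g0 h0; rewrite -integral_prodM//.
pose m12 : {sigma_finite_measure set (T1 * T2)%type -> \bar R} :=
  HB.pack (m1 \x m2)%E (Measure_isSigmaFinite.Build _ _ _ (m1 \x m2)%E
    (product_measure1_sigma_finite _ _ _ _ _ m1 m2)).
apply: (@integral_prodM R _ _ _ _ m12 m3 (fun w => f w.1 * g w.2) h) => //.
- apply: measurable_funM.
  + exact: (measurableT_comp mf measurable_fst).
  + exact: (measurableT_comp mg measurable_snd).
- by move=> w; rewrite mulr_ge0.
Qed.

Lemma integralT_oneDsqrV (R : realType) :
  (\int[@lebesgue_measure R]_x ((1 + x ^+ 2)^-1)%:E = pi%:E)%E.
Proof.
rewrite (@ge0_symfun_integralT _ (fun x => (oneDsqr x)^-1)).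
- by rewrite -set_itvcy integral0y_oneDsqr -EFinM; congr EFin; lra.
- by move=> x; rewrite invr_ge0; apply: le_trans (oneDsqr_ge1 x).
- exact: continuous_oneDsqrV.
- by move=> x; rewrite /oneDsqr /= sqrrN.
Qed.

Lemma continuous_G3 (R : realType) n : continuous (@G3 R n).
Proof.
move=> r; rewrite /G3; under eq_fun do rewrite laguerreE.
have sqrc (k : R) : {for r, continuous (fun r : R => k * r ^+ 2)}.
  by apply: cvgMl_tmp; exact: exprn_continuous.
apply: cvgM.
  apply: (@continuous_comp _ _ _ (fun r : R => - (pi * r ^+ 2)) expR).
    by apply: cvgN; exact: sqrc.
  exact: continuous_expR.
apply: (@continuous_comp _ _ _ (fun r : R => 2 * pi * r ^+ 2) (horner _)).
  exact: sqrc.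
exact: continuous_horner.
Qed.

Lemma measurable_radial3 (R : realType) (F : R -> R) : measurable_fun setT F ->
  measurable_fun setT (radial3 F).
Proof.
move=> mF; rewrite /radial3; apply: (measurableT_comp mF).
have ms : measurable_fun setT (@Num.sqrt R).
  by apply: continuous_measurable_fun; exact: sqrt_continuous.
apply: (measurableT_comp ms (g := fun v : R * R * R => v.1.1 ^+ 2 + v.1.2 ^+ 2 + v.2 ^+ 2)).
apply: measurable_funD.
  apply: measurable_funD; apply: measurable_funX.
    exact: (measurableT_comp measurable_fst measurable_fst).
  exact: (measurableT_comp measurable_snd measurable_fst).
by apply: measurable_funX; exact: measurable_snd.
Qed.

(** With s = 1 + |v|^2 one has s >= 1 + v_i^2 for each coordinate and s >= 1, so
    s^4 >= s^3 is at least the product of the three. *)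
Lemma radial3_dominated_sqr_le (R : realType) (v : R * R * R) :
  ((1 + euclid_norm3 v ^+ 2) ^+ 2)^-1 ^+ 2 <=
  (1 + v.1.1 ^+ 2)^-1 * (1 + v.1.2 ^+ 2)^-1 * (1 + v.2 ^+ 2)^-1.
Proof.
case: v => [[x y] z]; rewrite /euclid_norm3 /=.
have x0 := sqr_ge0 x; have y0 := sqr_ge0 y; have z0 := sqr_ge0 z.
rewrite sqr_sqrtr ?addr_ge0// -!invfM -exprVn.
move: (x ^+ 2) (y ^+ 2) (z ^+ 2) x0 y0 z0 => {}x {}y {}z x0 y0 z0.
have p w : 0 <= w -> 0 < 1 + w :> R by lra.
rewrite -exprM exprVn lef_pV2 ?posrE ?exprn_gt0 ?mulr_gt0 ?p ?addr_ge0//.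
set s := 1 + (x + y + z).
have s1 : 1 <= s by rewrite /s; lra.
apply: (@le_trans _ _ (s * s * s)).
  by apply: ler_pM; [apply: mulr_ge0| |apply: ler_pM|]; rewrite /s; lra.
by rewrite (_ : s * s * s = s ^+ 3) ?ler_weXn2l// !exprS expr0 mulr1 mulrA.
Qed.

(** J is the square root of pi^3, the integral over R^3 of the product of the
    1/(1 + v_i^2), which separates by Tonelli's theorem. *)
Lemma Lnorm2_radial3_le (R : realType) : exists2 J : R, 0 <= J &
  forall (f : R * R * R -> R) a, measurable_fun setT f -> 0 <= a ->
  (forall v, `|f v| <= a / (1 + euclid_norm3 v ^+ 2) ^+ 2) ->
  ('N[lebesgue_measure3]_2%:E[EFin \o f] <= (a * J)%:E)%E.
Proof.
exists (Num.sqrt (pi ^+ 3)); first exact: sqrtr_ge0.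
move=> f a mf a0 fa.
pose g (x : R) := (1 + x ^+ 2)^-1.
have g0 x : 0 <= g x by rewrite invr_ge0 addr_ge0// sqr_ge0.
have mg : measurable_fun setT g.
  by apply: continuous_measurable_fun; exact: continuous_oneDsqrV.
have I3 : (\int[lebesgue_measure3]_v (g v.1.1 * g v.1.2 * g v.2)%:E = (pi ^+ 3)%:E)%E.
  apply: (etrans (integral_prodM3 R _ _ _ _ _ _ (@lebesgue_measure R)
    (@lebesgue_measure R) (@lebesgue_measure R) g g g _ _ _ _ _ _)) => //.
  by rewrite integralT_oneDsqrV -!EFinM -!expr2 -exprSr.
rewrite Lnorm.unlock.
apply: (@le_trans _ _ (((a ^+ 2 * pi ^+ 3)%:E) `^ 2^-1)%E); last first.
  rewrite poweR_EFin lee_fin powR12_sqrt ?mulr_ge0 ?exprn_ge0 ?pi_ge0//.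
  by rewrite sqrtrM ?sqr_ge0// sqrtr_sqr ger0_norm.
apply: gt0_ler_poweR => //.
- by rewrite in_itv/= leey andbT; exact: integral_ge0.
- by rewrite in_itv/= leey andbT lee_fin mulr_ge0 ?exprn_ge0 ?pi_ge0.
have mg3 : measurable_fun setT (fun v : R * R * R => g v.1.1 * g v.1.2 * g v.2).
  apply: measurable_funM; first apply: measurable_funM.
  - exact: (measurableT_comp mg (measurableT_comp measurable_fst measurable_fst)).
  - exact: (measurableT_comp mg (measurableT_comp measurable_snd measurable_fst)).
  - exact: (measurableT_comp mg measurable_snd).
have g30 (v : R * R * R) : 0 <= g v.1.1 * g v.1.2 * g v.2 by rewrite !mulr_ge0.
rewrite EFinM -I3 -ge0_integralZl_EFin ?sqr_ge0//; first last.
- exact/measurable_EFinP.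
- by move=> v _; rewrite lee_fin.
apply: ge0_le_integral => //.
- by move=> v _; exact: poweR_ge0.
- apply/measurable_EFinP; apply: (measurableT_comp (measurable_powR 2)).
  exact: measurableT_comp.
- by apply/measurable_EFinP; apply: measurable_funM.
move=> v _; rewrite /= lee_fin powR_mulrn//.
apply: (@le_trans _ _ ((a / (1 + euclid_norm3 v ^+ 2) ^+ 2) ^+ 2)).
  by rewrite lerXn2r ?nnegrE ?divr_ge0 ?sqr_ge0.
by rewrite exprMn ler_wpM2l ?sqr_ge0// radial3_dominated_sqr_le.
Qed.

(** The terms are at most K/(1 + r^2)^2 times 1/((n + 1) (n + 2)), whose tails
    telescope; the bound on the remainder passes to the limit in M of the difference of
    two partial sums. *)
Lemma partial_sum_bounds (R : realType) : exists2 K : R, 0 <= K & forall N r,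
  `|\sum_(0 <= n < N) c n * G3 n r| <= K / (1 + r ^+ 2) ^+ 2 /\
  `|A r - \sum_(0 <= n < N) c n * G3 n r| <= K / N.+1%:R / (1 + r ^+ 2) ^+ 2.
Proof.
have [E E0 hE] := c_bound R; have [B B0 hB] := G3_bound R.
pose K := 2 * (E * B).
have K0 : 0 <= K by rewrite !mulr_ge0.
exists K => // N r; set h := (1 + r ^+ 2) ^+ 2.
have h0 : 0 < h by rewrite exprn_gt0// ltr_wpDr ?sqr_ge0.
have term n : `|c n * G3 n r| <= K / h * teles n.
  have n0 : 0 < n.+1%:R :> R by rewrite ltr0n.
  rewrite normrM; apply: (@le_trans _ _ ((E / n.+1%:R ^+ 6) * (B * n.+1%:R ^+ 4 / h))).
    have G3n : `|G3 n r| <= B * n.+1%:R ^+ 4 / h by rewrite ler_pdivlMr// mulrC hB.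
    by apply: ler_pM.
  rewrite (_ : E / n.+1%:R ^+ 6 * (B * n.+1%:R ^+ 4 / h) = E * B / h * (n.+1%:R ^+ 2)^-1).
    rewrite /K (_ : 2 * (E * B) / h * teles n = E * B / h * (2 * teles n)); last by ring.
    by rewrite ler_wpM2l ?invr_sqr_teles_le// divr_ge0 ?(ltW h0)// mulr_ge0.
  by field; rewrite (gt_eqF h0) nat1r pnatr_eq0.
split; first exact: sum_normr_teles_le.
pose S M := \sum_(0 <= n < M) c n * G3 n r.
have SA : S (M + N)%N - S N @[M --> \oo] --> A r - S N.
  apply: cvgB; last exact: cvg_cst.
  by rewrite (cvg_shiftn N S); exact: A_expansion.
apply: (@ler_cvgn _ (fun M => `|S (M + N)%N - S N|) (fun=> K / N.+1%:R / h)).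
- exact: cvg_norm.
- exact: cvg_cst.
- move=> M; rewrite /S (big_cat_nat _ (n := N)) ?leq_addl//= [X in X - _]addrC addrK.
  apply: le_trans (ler_norm_sum _ _ _) _.
  apply: le_trans (ler_sum _ (fun n _ => term n)) _.
  by rewrite -mulr_sumr [leRHS]mulrAC ler_wpM2l ?sum_teles_le// divr_ge0// ltW.
Qed.

Theorem theorem4p7 (R : realType) :
  (forall r : R, 0 < r ->
     (\sum_(0 <= n < N) c n * G3 n r) @[N --> \oo] --> A r) /\
  L2_cvg lebesgue_measure3
    (fun N (v : R * R * R) => \sum_(0 <= n < N) c n * radial3 (G3 n) v)
    (radial3 A).
Proof.
split; first by move=> r _; exact: A_expansion.
have [K K0 hK] := partial_sum_bounds R; have [J J0 hJ] := Lnorm2_radial3_le R.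
pose S N (v : R * R * R) := \sum_(0 <= n < N) c n * radial3 (G3 n) v.
have mS N : measurable_fun setT (S N).
  apply: measurable_sum => n; apply: measurable_funM => //.
  by apply: measurable_radial3; apply: continuous_measurable_fun; exact: continuous_G3.
have mA : measurable_fun setT (radial3 A : R * R * R -> R).
  by apply: (measurable_fun_cvg mS) => v _; exact: A_expansion.
have LfunP (f : R * R * R -> R) (a : R) : measurable_fun setT f -> 0 <= a ->
    (forall v, `|f v| <= a / (1 + euclid_norm3 v ^+ 2) ^+ 2) ->
    f \in Lfun (@lebesgue_measure3 R) 2%:E.
  move=> mf a0 fa; rewrite inE; apply/andP; split; rewrite inE//=.
  by rewrite /finite_norm; apply: le_lt_trans (hJ f a mf a0 fa) _; rewrite ltry.
split.
- by move=> N; apply: (LfunP _ K (mS N) K0) => v; have [] := hK N (euclid_norm3 v).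
- apply: (LfunP _ K mA K0) => v; have [_] := hK 0%N (euclid_norm3 v).
  by rewrite big_geq// subr0 divr1.
have up N : ('N[lebesgue_measure3]_2%:E[EFin \o (radial3 A \- S N)%R] <=
    (K / N.+1%:R * J)%:E)%E.
  apply: hJ; [exact: measurable_funB|by rewrite divr_ge0|move=> v].
  by have [] := hK N (euclid_norm3 v).
apply: (@squeeze_cvge _ _ _ _ (cst 0%E) _ (fun N => (K / N.+1%:R * J)%:E)).
- by apply: nearW => N; rewrite Lnorm_ge0 up.
- exact: cvg_cst.
- apply: cvg_EFin; first exact: nearW.
  rewrite [X in _ --> X](_ : 0 = K * 0 * J); last by rewrite mulr0 mul0r.
  by apply: cvgMr_tmp; apply: cvgMl_tmp; exact: cvg_harmonic.
Qed.
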